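(* Let $X$ be any topological space and $\mathbf M$ the ideal of meager subsets of $X$. For $a\in\wp(X)/\mathbf M$ define $\mathbf c\, a$ to be the least closed element of $\wp(X)/\mathbf M$ above $a$ (which exists). Then $(\wp(X)/\mathbf M,\mathbf c)$ is a monadic algebra.
   Context: A subset is nowhere dense if the interior of its closure is empty, and meager if it is a countable union of nowhere dense sets. In the quotient Boolean algebra $\wp(X)/\mathbf M$, $[A]$ is the class of $A$, $[A]\sqsubseteq[B]$ iff $A\setminus B$ is meager; an element is closed if it equals $[F]$ for some closed $F\subseteq X$. A closure algebra is a Boolean algebra $B$ with $\mathbf c:B\to B$ such that $a\le \mathbf c a$, $\mathbf c\mathbf c a\le \mathbf c a$, $\mathbf c(a\vee b)=\mathbf c a\vee \mathbf c b$, $\mathbf c0=0$; with $\mathbf i a:=-\mathbf c(-a)$, it is a monadic algebra if moreover $\mathbf c a=\mathbf i\mathbf c a$ for all $a$. *)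

(* Defs.v *)
From HB Require Import structures.
From mathcomp Require Import all_boot all_order generic_quotient.
From mathcomp Require Import boolp classical_sets topology.

Set Implicit Arguments.
Unset Strict Implicit.
Unset Printing Implicit Defensive.

Local Open Scope classical_set_scope.
Local Open Scope quotient_scope.

Section meager.
Context {X : topologicalType}.
Implicit Types A B C : set X.

Definition nowhere_dense A := (closure A)° = set0.

Definition meager A :=
  exists2 F : nat -> set X,
    (forall n, nowhere_dense (F n)) & A = \bigcup_n F n.

Lemma nowhere_dense0 : nowhere_dense (set0 : set X).
Proof. by rewrite /nowhere_dense closure0 interior0. Qed.

Lemma nowhere_dense_sub A B : A `<=` B -> nowhere_dense B -> nowhere_dense A.
Proof.
move=> AB B0; rewrite /nowhere_dense -subset0 -B0.
exact/interiorS/closureS.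
Qed.

Lemma meager0 : meager (set0 : set X).
Proof.
by exists (fun=> set0) => [_|]; [exact: nowhere_dense0|rewrite bigcup0].
Qed.

Lemma meager_sub A B : A `<=` B -> meager B -> meager A.
Proof.
move=> AB [F F0 BF]; exists (fun n => A `&` F n).
  by move=> n; apply: nowhere_dense_sub (F0 n) => x [].
by rewrite -setI_bigcupr -BF; apply/esym/setIidPl.
Qed.

Lemma meagerU A B : meager A -> meager B -> meager (A `|` B).
Proof.
move=> [F F0 ->] [G G0 ->].
exists (fun n => if odd n then G n./2 else F n./2).
  by move=> n; case: ifP.
apply/seteqP; split=> [x [[n _ Fx]|[n _ Gx]]|x [n _]].
- by exists n.*2 => //=; rewrite odd_double doubleK.
- by exists n.*2.+1 => //=; rewrite odd_double /= uphalf_double.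
- by case: ifP => _ Hx; [right|left]; exists n./2.
Qed.

Definition meager_eq A B : bool :=
  `[< meager ((A `\` B) `|` (B `\` A)) >].

Lemma meager_eqP A B :
  reflect (meager (A `\` B) /\ meager (B `\` A)) (meager_eq A B).
Proof.
apply: (iffP (asboolP _)) => [AB|[AB BA]]; last exact: meagerU.
by split; apply: meager_sub AB => x; [left|right].
Qed.

Lemma meager_setD_trans A B C :
  meager (A `\` B) -> meager (B `\` C) -> meager (A `\` C).
Proof.
move=> AB BC; apply: meager_sub (meagerU AB BC) => x [Ax Cx].
by have [Bx|Bx] := pselect (B x); [right|left].
Qed.

Lemma meager_setDv A : meager (A `\` A).
Proof. by rewrite setDv; exact: meager0. Qed.

Lemma meager_eq_refl : reflexive meager_eq.
Proof. by move=> A; apply/meager_eqP; split; exact: meager_setDv. Qed.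

Lemma meager_eq_sym : symmetric meager_eq.
Proof. by move=> A B; rewrite /meager_eq setUC. Qed.

Lemma meager_eq_trans : transitive meager_eq.
Proof.
move=> B A C /meager_eqP[AB BA] /meager_eqP[BC CB]; apply/meager_eqP.
by split; [exact: meager_setD_trans AB BC|exact: meager_setD_trans CB BA].
Qed.

Canonical meager_equiv :=
  EquivRel meager_eq meager_eq_refl meager_eq_sym meager_eq_trans.

End meager.

Definition pow_mod_meager (X : topologicalType) := {eq_quot @meager_equiv X}.

HB.instance Definition _ (X : topologicalType) :=
  Choice.on (pow_mod_meager X).
HB.instance Definition _ (X : topologicalType) :=
  EqQuotient.on (pow_mod_meager X).

Fact meager_display : Order.disp_t. Proof. exact: (Order.Disp tt tt). Qed.

Section boolean_algebra.
Variable X : topologicalType.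
Local Notation Q := (pow_mod_meager X).
Implicit Types (A B : set X) (a b c : Q).

Definition mclass A : Q := \pi_Q A.

Lemma class_eqP A B :
  mclass A = mclass B <-> meager (A `\` B) /\ meager (B `\` A).
Proof.
split=> [/eqP|AB]; first by rewrite eqmodE => /meager_eqP.
by apply/eqP; rewrite eqmodE; apply/meager_eqP.
Qed.

Lemma classK a : mclass (repr a) = a. Proof. exact: reprK. Qed.

Lemma class_ind (P : Q -> Prop) : (forall A, P (mclass A)) -> forall a, P a.
Proof. by move=> PA a; rewrite -(classK a). Qed.

Lemma meager_repr A :
  meager (A `\` repr (mclass A)) /\ meager (repr (mclass A) `\` A).
Proof. by apply/class_eqP; rewrite classK. Qed.

Definition qle a b : bool := `[< meager (repr a `\` repr b) >].
Definition qlt a b : bool := (b != a) && qle a b.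
Definition qmeet a b : Q := mclass (repr a `&` repr b).
Definition qjoin a b : Q := mclass (repr a `|` repr b).
Definition qcompl a : Q := mclass (~` repr a).

Lemma qle_class A B : qle (mclass A) (mclass B) <-> meager (A `\` B).
Proof.
have [A1 A2] := meager_repr A; have [B1 B2] := meager_repr B.
split=> [/asboolP|] AB.
  exact/(meager_setD_trans A1)/(meager_setD_trans AB).
by apply/asboolP/(meager_setD_trans A2)/(meager_setD_trans AB).
Qed.

Lemma qmeet_class A B : qmeet (mclass A) (mclass B) = mclass (A `&` B).
Proof.
have [A1 A2] := meager_repr A; have [B1 B2] := meager_repr B.
apply/class_eqP; split.
  apply: meager_sub (meagerU A2 B2) => x [[Ax Bx] nAB].
  by have [Ax'|] := pselect (A x); [right; split=> // Bx'; exact: nAB|left].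
apply: meager_sub (meagerU A1 B1) => x [[Ax Bx] nAB].
have [Ax'|] := pselect (repr (mclass A) x); last by left.
by right; split=> // Bx'; exact: nAB.
Qed.

Lemma qjoin_class A B : qjoin (mclass A) (mclass B) = mclass (A `|` B).
Proof.
have [A1 A2] := meager_repr A; have [B1 B2] := meager_repr B.
apply/class_eqP; split.
  by apply: meager_sub (meagerU A2 B2) => x [[Ax|Bx] nAB];
    [left|right]; split=> // H; apply: nAB; [left|right].
by apply: meager_sub (meagerU A1 B1) => x [[Ax|Bx] nAB];
  [left|right]; split=> // H; apply: nAB; [left|right].
Qed.

Lemma qcompl_class A : qcompl (mclass A) = mclass (~` A).
Proof.
have [A1 A2] := meager_repr A; apply/class_eqP; split.
  by apply: meager_sub A1 => x [nA /contrapT].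
by apply: meager_sub A2 => x [nA /contrapT].
Qed.

Fact qle_def a b : qle a b = (qmeet a b == a).
Proof.
elim/class_ind: a => A; elim/class_ind: b => B; rewrite qmeet_class.
apply/idP/eqP => [/qle_class AB|/class_eqP[_ AB]].
  apply/class_eqP; split.
    by apply: meager_sub meager0 => x [[]].
  by apply: meager_sub AB => x [Ax nAB]; split=> // Bx; exact: nAB.
by apply/qle_class; apply: meager_sub AB => x [Ax Bx]; split=> // -[].
Qed.

Fact qlt_def a b : qlt a b = (b != a) && qle a b. Proof. by []. Qed.

Fact qmeetC : commutative qmeet.
Proof.
by elim/class_ind=> A; elim/class_ind=> B; rewrite !qmeet_class setIC.
Qed.

Fact qjoinC : commutative qjoin.
Proof.
by elim/class_ind=> A; elim/class_ind=> B; rewrite !qjoin_class setUC.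
Qed.

Fact qmeetA : associative qmeet.
Proof.
elim/class_ind=> A; elim/class_ind=> B; elim/class_ind=> C.
by rewrite !qmeet_class setIA.
Qed.

Fact qjoinA : associative qjoin.
Proof.
elim/class_ind=> A; elim/class_ind=> B; elim/class_ind=> C.
by rewrite !qjoin_class setUA.
Qed.

Fact qjoinKI b a : qmeet a (qjoin a b) = a.
Proof.
elim/class_ind: a => A; elim/class_ind: b => B.
by rewrite qjoin_class qmeet_class setUC setKU.
Qed.

Fact qmeetKU b a : qjoin a (qmeet a b) = a.
Proof.
elim/class_ind: a => A; elim/class_ind: b => B.
by rewrite qmeet_class qjoin_class setIC setKI.
Qed.

Fact qmeetUl : left_distributive qmeet qjoin.
Proof.
elim/class_ind=> A; elim/class_ind=> B; elim/class_ind=> C.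
by rewrite !(qmeet_class, qjoin_class) setIUl.
Qed.

Fact qmeetxx : idempotent_op qmeet.
Proof. by elim/class_ind=> A; rewrite qmeet_class setIid. Qed.

HB.instance Definition _ :=
  Order.isMeetJoinDistrLattice.Build meager_display Q
    qle_def qlt_def qmeetC qjoinC qmeetA qjoinA qjoinKI qmeetKU qmeetUl qmeetxx.

Fact qle0x a : (mclass set0 <= a)%O.
Proof.
elim/class_ind: a => A; apply/qle_class.
by rewrite set0D; exact: meager0.
Qed.

Fact qlex1 a : (a <= mclass setT)%O.
Proof.
elim/class_ind: a => A; apply/qle_class.
by rewrite setDT; exact: meager0.
Qed.

HB.instance Definition _ := Order.hasBottom.Build meager_display Q qle0x.
HB.instance Definition _ := Order.hasTop.Build meager_display Q qlex1.

Fact qjoinxC a : (a `|` qcompl a = \top)%O.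
Proof.
by elim/class_ind: a => A; rewrite qcompl_class [LHS]qjoin_class setUv.
Qed.

Fact qmeetxC a : (a `&` qcompl a = \bot)%O.
Proof.
by elim/class_ind: a => A; rewrite qcompl_class [LHS]qmeet_class setICr.
Qed.

HB.instance Definition _ :=
  Order.TBDistrLattice_hasComplement.Build meager_display Q qjoinxC qmeetxC.

Lemma le_class A B : (mclass A <= mclass B)%O <-> meager (A `\` B).
Proof. exact: qle_class. Qed.

Lemma meet_class A B : (mclass A `&` mclass B)%O = mclass (A `&` B).
Proof. exact: qmeet_class. Qed.

Lemma join_class A B : (mclass A `|` mclass B)%O = mclass (A `|` B).
Proof. exact: qjoin_class. Qed.

Lemma compl_class A : (~` mclass A)%O = mclass (~` A).
Proof. exact: qcompl_class. Qed.

Lemma bot_class : (\bot : Q)%O = mclass set0. Proof. by []. Qed.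

Lemma top_class : (\top : Q)%O = mclass setT. Proof. by []. Qed.

End boolean_algebra.

Section closure_algebra.
Context {d : Order.disp_t} {B : ctbDistrLatticeType d}.
Variable c : B -> B.
Local Open Scope order_scope.

Record is_closure_algebra : Prop := IsClosureAlgebra {
  closure_alg_ge : forall a : B, a <= c a ;
  closure_alg_idem : forall a : B, c (c a) <= c a ;
  closure_alg_join : forall a b : B, c (a `|` b) = c a `|` c b ;
  closure_alg_bot : c \bot = \bot }.

Definition interior_op (a : B) : B := ~` c (~` a).

Definition is_monadic_algebra : Prop :=
  is_closure_algebra /\ forall a : B, c a = interior_op (c a).

End closure_algebra.

Section closure_operator.
Context {X : topologicalType}.
Implicit Types a b e : pow_mod_meager X.

Definition closed_elt b : Prop := exists2 F : set X, closed F & b = mclass F.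

Definition is_least_closed_above a b : Prop :=
  [/\ closed_elt b, (a <= b)%O &
      forall e, closed_elt e -> (a <= e)%O -> (b <= e)%O].

(* The default value of xget is irrelevant once a least closed element above
   a exists; it is then unique by antisymmetry. *)
Definition meager_closure a : pow_mod_meager X :=
  xget a [set b | is_least_closed_above a b].

End closure_operator.

(* Main.v *)
Require Import Defs.
From mathcomp Require Import all_boot all_order.
From mathcomp Require Import boolp classical_sets topology.

(** For a set [A], let [U] be the union of all open sets whose trace on [A] is
    meager.  By the Banach category theorem [U `&` A] is itself meager: a
    maximal disjoint family of such open sets is dense in [U], and disjointness
    lets one glue their n-th nowhere dense pieces into one nowhere dense set.
    Hence the class of the closed set [~` U] is the least closed element above
    the class of [A].  An open set differs from its closure by a nowhere dense
    set, so the closed elements are stable under complement, which gives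
    [c a = i (c a)]. *)

Local Open Scope classical_set_scope.

Section category.
Context {X : topologicalType}.
Implicit Types A O W : set X.

Lemma nowhere_denseP A :
  nowhere_dense A <-> forall O, open O -> O `<=` closure A -> O = set0.
Proof.
split=> [A0 O oO OA|A0].
  by rewrite -subset0 -A0 -open_subsetE.
by apply: A0; [exact: open_interior|exact: interior_subset].
Qed.

Lemma nowhere_dense_meager A : nowhere_dense A -> meager A.
Proof.
move=> A0; exists (fun=> A) => //.
by rewrite bigcup_const //; exists 0%N.
Qed.

(** A nonempty open [O] inside the closure of the boundary would meet [W]; then [O] intersected with
    [W] is open and nonempty, yet would have to contain a point outside [W]. *)
Lemma nowhere_dense_boundary W : open W -> nowhere_dense (closure W `\` W).
Proof.
move=> oW; apply/nowhere_denseP => O oO OW; rewrite -subset0 => x Ox.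
have [y [[Wy _] Oy]] := OW x Ox O (open_nbhs_nbhs (conj oO Ox)).
have [z [Wz Oz]] := Wy O (open_nbhs_nbhs (conj oO Oy)).
have [t [[_ nWt] [_ Wt]]] :=
  OW z Oz _ (open_nbhs_nbhs (conj (openI oO oW) (conj Oz Wz))).
exact: nWt.
Qed.

(** Within one open member [V], disjointness leaves only [N V] of the union, so density of the union
    in a part of [V] would be density of [N V] there. *)
Lemma nowhere_dense_bigcup_disjoint (E : set (set X)) (N : set X -> set X) :
    (forall V, E V -> open V) -> trivIset E id ->
    (forall V, E V -> nowhere_dense (N V)) ->
  nowhere_dense (\bigcup_(V in E) (V `&` N V)).
Proof.
move=> oE tE N0; apply/nowhere_denseP => O oO ON; rewrite -subset0 => x Ox.
have [y [[V EV [Vy _]] Oy]] := ON x Ox O (open_nbhs_nbhs (conj oO Ox)).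
have oOV : open (O `&` V) by apply: openI => //; exact: oE.
have OV0 : O `&` V = set0.
  apply: ((nowhere_denseP _).1 (N0 V EV)) => // z [Oz Vz] B nB.
  have [t [[V' EV' [V't NV't]] [Bt [_ Vt]]]] := ON z Oz _
    (filterI nB (open_nbhs_nbhs (conj oOV (conj Oz Vz)))).
  by exists t; split=> //; rewrite -(tE V' V EV' EV) //; exists t.
by have : (O `&` V) y by []; rewrite OV0.
Qed.

Lemma meager_bigcup_open A :
  meager (A `&` \bigcup_(O in [set O | open O /\ meager (A `&` O)]) O).
Proof.
set D := [set O | _]; set U := \bigcup_(O in D) O.
have [E [ED tE maxE]] := ex_maximal_disjoint_subcollection id D.
pose W := \bigcup_(V in E) V.
have oE V : E V -> open V by move=> /ED[].
have oW : open W by exact: bigcup_open.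
(* Otherwise [O'], the part of [O] outside [closure W], could be added to [E]: it contains [x], is
   open with meager trace on [A], and misses every member of [E]. *)
have UW : U `<=` closure W.
  move=> x [O [oO AO] Ox]; apply: contrapT => nWx.
  pose O' := O `\` closure W.
  have nEO' : ~ E O'.
    by move=> EO'; apply: (nWx); apply: subset_closure; exists O'.
  apply: (maxE (E `|` [set O'])).
  - split=> [V EV|EO']; first by left.
    by apply: nEO'; apply: EO'; right.
  - move=> V [/ED//|->]; split.
      by apply: openI => //; apply: closed_openC; exact: closed_closure.
    by apply: meager_sub AO => y [Ay [Oy _]].
  - have dO' V y : E V -> V y -> ~ O' y.
      by move=> EV Vy [_]; apply; apply: subset_closure; exists V.
    move=> V V' [EV|->] [EV'|->] // [y [Vy V'y]].
    + by apply: tE => //; exists y.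
    + by case: (dO' _ _ EV Vy).
    + by case: (dO' _ _ EV' V'y).
have AW : meager (A `&` W).
  (* Choose one decomposition per [V], so that the pieces can be regrouped by the index [n] instead
     of by [V]; [E] may be uncountable. *)
  have /choice[N NE] (V : set X) : exists F : nat -> set X, E V ->
      (forall n, nowhere_dense (F n)) /\ A `&` V = \bigcup_n F n.
    have [EV|nEV] := pselect (E V); last by exists (fun=> set0).
    by have [_ [F F0 AV]] := ED V EV; exists F.
  apply: (@meager_sub _ _ (\bigcup_n \bigcup_(V in E) (V `&` N V n))).
    move=> x [Ax [V EV Vx]]; have [_ AV] := NE V EV.
    have [n _ Nx] : (\bigcup_n N V n) x by rewrite -AV.
    by exists n => //; exists V.
  exists (fun n => \bigcup_(V in E) (V `&` N V n)) => // n.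
  by apply: nowhere_dense_bigcup_disjoint => // V /NE[].
(* What [U] has outside [W] lies in the boundary of [W]. *)
have bW := nowhere_dense_meager _ (nowhere_dense_boundary W oW).
apply: meager_sub (meagerU AW bW) => x [Ax Ux].
by have [Wx|nWx] := pselect (W x); [left|right; split=> //; exact: UW].
Qed.

End category.

Section closed_elements.
Context {X : topologicalType}.
Implicit Types a b e : pow_mod_meager X.
Import Order.LTheory Order.CTheory.
Local Open Scope order_scope.

Lemma ex_least_closed_above a : exists b, is_least_closed_above a b.
Proof.
elim/class_ind: a => A.
set U := (\bigcup_(O in [set O | open O /\ meager (A `&` O)]) O)%classic.
have AU : meager (A `&` U) := meager_bigcup_open A.
exists (mclass (~` U)%classic); split.
- by exists (~` U)%classic => //; apply/open_closedC/bigcup_open => O [].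
- by apply/le_class; rewrite setDE setCK.
- move=> _ [G cG ->] /le_class AG; apply/le_class.
  (* The complement of [G] is one of the open sets making up [U], so the inclusion holds exactly,
     not just modulo meager sets. *)
  rewrite (_ : _ `\` _ = set0)%classic; first exact: meager0.
  rewrite -subset0 => x [nUx nGx]; apply: nUx.
  by exists (~` G)%classic => //; split; [exact: closed_openC|rewrite -setDE].
Qed.

Lemma meager_closureP a : is_least_closed_above a (meager_closure a).
Proof. exact: (xgetPex a (ex_least_closed_above a)). Qed.

Lemma meager_closure_id a : closed_elt a -> meager_closure a = a.
Proof.
move=> ca; have [_ a_le lea] := meager_closureP a.
by apply/le_anti; rewrite a_le lea.
Qed.

Lemma closed_eltU a b : closed_elt a -> closed_elt b -> closed_elt (a `|` b).
Proof.
move=> [F cF ->] [G cG ->]; exists (F `|` G)%classic; first exact: closedU.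
exact: join_class.
Qed.

Lemma closed_eltC a : closed_elt a -> closed_elt (~` a).
Proof.
move=> [F cF ->]; exists (closure (~` F)); first exact: closed_closure.
rewrite compl_class; apply/class_eqP; split.
  apply: meager_sub meager0 => x [Fx nFx]; apply: nFx.
  exact: subset_closure.
exact/nowhere_dense_meager/nowhere_dense_boundary/closed_openC.
Qed.

Lemma closed_elt0 : closed_elt (\bot : pow_mod_meager X).
Proof. by exists set0; [exact: closed0|exact: bot_class]. Qed.

Lemma le_meager_closure a b : a <= b -> meager_closure a <= meager_closure b.
Proof.
move=> ab; have [cb b_le _] := meager_closureP b.
have [_ _] := meager_closureP a; apply=> //.
exact: le_trans ab b_le.
Qed.

Lemma meager_closure_monadic : is_monadic_algebra (@meager_closure X).
Proof.
have cl a : closed_elt (meager_closure a) by have [] := meager_closureP a.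
have ge a : a <= meager_closure a by have [] := meager_closureP a.
split; last first.
  (* The complement of the closed element [c a] is closed, hence fixed by [c]; complementing again
     returns [c a]. *)
  move=> a; rewrite /interior_op (meager_closure_id (~` meager_closure a)).
    by rewrite complK.
  exact: closed_eltC.
split=> // [a|a b|].
- by rewrite meager_closure_id.
(* One inequality is monotonicity; the other is leastness, since the join of the two closures is
   closed. *)
- apply/le_anti/andP; split; last first.
    by rewrite leUx !le_meager_closure ?leUl ?leUr.
  have [_ _] := meager_closureP (a `|` b); apply; first exact: closed_eltU.
  exact: leU2.
- by rewrite meager_closure_id //; exact: closed_elt0.
Qed.

End closed_elements.

Theorem theorem3p9 (X : topologicalType) :
  (forall a : pow_mod_meager X,
     exists b : pow_mod_meager X, is_least_closed_above a b) /\
  is_monadic_algebra (@meager_closure X).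
Proof. split; [exact: ex_least_closed_above|exact: meager_closure_monadic]. Qed.
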